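(* For every infinite set $\Gamma$, the Banach space $c_0(\Gamma)$ admits a star-finite covering $\mathcal B$ by Fréchet smooth centrally symmetric bounded bodies.
   Context: $c_0(\Gamma)$ is the real Banach space of functions $x:\Gamma\to\mathbb R$ vanishing at infinity (i.e. $\{\gamma:|x(\gamma)|>\epsilon\}$ is finite for each $\epsilon>0$), with the supremum norm. A body is a closed convex set with nonempty interior. A bounded body $B$ is centrally symmetric if $B-c=-(B-c)$ for some point $c$ (its center); such a body is a translate $c+B_0$ of the closed unit ball $B_0$ of an equivalent norm on $c_0(\Gamma)$, and it is Fréchet smooth if that norm is Fréchet differentiable at every nonzero point. A covering is a family of nonempty sets whose union is the whole space. A family of sets is star-finite if each of its members intersects only finitely many other members. *)

(* Defs.v *)
From HB Require Import structures.
From mathcomp Require Import all_boot all_order all_algebra.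
From mathcomp Require Import all_classical all_reals all_analysis.

Set Implicit Arguments.
Unset Strict Implicit.
Unset Printing Implicit Defensive.

Import Order.TTheory GRing.Theory Num.Theory.
Import numFieldNormedType.Exports.

Local Open Scope classical_set_scope.
Local Open Scope ring_scope.

Section c0_space.
Variables (R : realType) (G : Type).

Definition vanishing_at_infinity (x : G -> R) : Prop :=
  forall e : R, 0 < e -> finite_set [set g | e < `|x g|].

Definition c0_pred : {pred G -> R} := [pred x | `[< vanishing_at_infinity x >]].

Lemma c0_predP (x : G -> R) : reflect (vanishing_at_infinity x) (x \in c0_pred).
Proof. exact: asboolP. Qed.

Lemma c0_submod_closed : submod_closed c0_pred.
Proof.
split=> [|a x y /c0_predP x0 /c0_predP y0]; apply/c0_predP => e e0.
  rewrite [X in finite_set X](_ : _ = set0)// -subset0 => g /=.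
  by rewrite normr0 ltNge ltW.
have k0 : 0 < e / 2 / (`|a| + 1) by rewrite !divr_gt0// ltr_wpDl.
apply: (@sub_finite_set _ _
  ([set g | e / 2 / (`|a| + 1) < `|x g|] `|` [set g | e / 2 < `|y g|])).
  move=> g /= eg; apply: contrapT => /not_orP[/negP + /negP].
  rewrite -!leNgt => xg yg; move: eg; apply/negP; rewrite -leNgt.
  rewrite (le_trans (ler_normD _ _))// [leRHS]splitr lerD// normrM.
  rewrite ler_pdivlMr ?ltr_wpDl// in xg.
  by rewrite (le_trans _ xg)// mulrC ler_wpM2l// lerDl.
by rewrite finite_setU; split; [exact: x0|apply: y0; rewrite divr_gt0].
Qed.

HB.instance Definition _ :=
  GRing.isSubmodClosed.Build R (G -> R) c0_pred c0_submod_closed.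

Record c0 := C0 { c0_fun :> G -> R ; c0_funP : c0_fun \in c0_pred }.

HB.instance Definition _ := [isSub for c0_fun].
HB.instance Definition _ := [Choice of c0 by <:].
HB.instance Definition _ := [SubChoice_isSubLmodule of c0 by <:].

(* [sup set0] is 0, so this is also the right norm when [G] is empty. *)
Definition c0_norm (x : c0) : R := sup [set `|x g| | g in [set: G]].

Lemma c0_vanishing (x : c0) : vanishing_at_infinity x.
Proof. exact/c0_predP/c0_funP. Qed.

Lemma c0_bounded (x : c0) : has_ubound [set `|x g| | g in [set: G]].
Proof.
have fin := @c0_vanishing x 1 ltr01.
have [M MP] : has_ubound ((fun g => `|x g|) @` [set g | 1 < `|x g|]).
  have : finite_set ((fun g => `|x g|) @` [set g | 1 < `|x g|]).
    exact: finite_image.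
  move/finite_seqP => [s ->].
  exists (\sum_(r <- s) `|r|) => r /= rs.
  by rewrite (big_rem r)//= (le_trans (ler_norm r))// lerDl sumr_ge0.
exists (Num.max M 1) => _ [g _ <-]; rewrite le_max.
by have [xg|xg] := leP `|x g| 1; [rewrite orbT|rewrite MP//; exists g].
Qed.

Lemma c0_normE_ub (x : c0) (g : G) : `|x g| <= c0_norm x.
Proof. by apply: ub_le_sup; [exact: c0_bounded|exists g]. Qed.

Lemma c0_norm_le (x : c0) (M : R) :
  0 <= M -> (forall g, `|x g| <= M) -> c0_norm x <= M.
Proof.
move=> M0 xM; rewrite /c0_norm; have [->|/set0P ne] :=
    eqVneq [set `|x g| | g in [set: G]] set0.
  by rewrite sup0.
by apply: ge_sup => // _ [g _ <-].
Qed.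

Lemma c0_norm_ge0 (x : c0) : 0 <= c0_norm x.
Proof.
rewrite /c0_norm; have [->|/set0P[_ [g _ _]]] :=
    eqVneq [set `|x g| | g in [set: G]] set0; first by rewrite sup0.
exact: le_trans (c0_normE_ub x g).
Qed.

Let c0_ler_normD (x y : c0) : c0_norm (x + y) <= c0_norm x + c0_norm y.
Proof.
apply: c0_norm_le => [|g]; first by rewrite addr_ge0// c0_norm_ge0.
by rewrite (le_trans (ler_normD _ _))// lerD// c0_normE_ub.
Qed.

Let c0_normrZ_le (a : R) (x : c0) : c0_norm (a *: x) <= `|a| * c0_norm x.
Proof.
apply: c0_norm_le => [|g]; first by rewrite mulr_ge0// c0_norm_ge0.
by rewrite [X in `|X|](_ : _ = a * x g)// normrM ler_wpM2l// c0_normE_ub.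
Qed.

Let c0_normrZ (a : R) (x : c0) : c0_norm (a *: x) = `|a| * c0_norm x.
Proof.
apply/eqP; rewrite eq_le c0_normrZ_le/=.
have [->|a0] := eqVneq a 0; first by rewrite normr0 mul0r c0_norm_ge0.
have := c0_normrZ_le a^-1 (a *: x).
rewrite scalerA mulVf// scale1r normrV ?unitfE//.
by rewrite ler_pdivlMl ?normr_gt0.
Qed.

Let c0_normr0_eq0 (x : c0) : c0_norm x = 0 -> x = 0.
Proof.
move=> x0; apply: val_inj; apply/funext => g /=.
by apply/eqP; rewrite -normr_le0 -x0 c0_normE_ub.
Qed.

HB.instance Definition _ := Lmodule_isNormed.Build R c0
  c0_ler_normD c0_normrZ c0_normr0_eq0.

Lemma c0_normE (x : c0) : `|x| = sup [set `|x g| | g in [set: G]].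
Proof. by []. Qed.

Lemma c0_complete (F : set_system c0) :
  ProperFilter F -> cauchy F -> cvg F.
Proof.
move=> FF /cauchy_ballP Fc.
have Fnear (e : R) : 0 < e ->
    exists2 A, F A & forall x y, A x -> A y -> `|x - y| < e.
  move=> e0; have := Fc _ e0; rewrite near_simpl.
  move=> -[[A B]/= [FA FB] AB]; exists (A `&` B); first exact: filterI.
  move=> x y [Ax _] [_ By].
  by have := AB (x, y) (conj Ax By); rewrite -ball_normE.
have FcR (g : G) : cvg ((fun x : c0 => x g) @ F).
  apply: R_complete; apply/cauchy_ballP => e e0.
  have [A FA Ae] := Fnear e e0.
  exists ((fun x : c0 => x g) @` A, (fun x : c0 => x g) @` A) => /=.
    by split; apply: (@filterS _ F FF A _ _ FA) => x Ax; exists x.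
  move=> [_ _] [/= [x Ax <-] [y Ay <-]]; rewrite -ball_normE /ball_/=.
  exact: le_lt_trans (c0_normE_ub (x - y) g) (Ae _ _ Ax Ay).
pose l g : R := lim ((fun x : c0 => x g) @ F).
have lP (A : set c0) (e : R) : F A ->
    (forall x y, A x -> A y -> `|x - y| < e) ->
    forall x, A x -> forall g, `|x g - l g| <= e.
  move=> FA Ae x Ax g.
  have /cvgrPdist_le h := FcR g.
  apply/ler_addgt0Pr => d d0.
  have [y [Ay yd]] := @filter_ex _ F FF _ (filterI FA (h _ d0)).
  rewrite (le_trans (ler_distD (y g) _ _))// lerD//.
    exact/ltW/(le_lt_trans (c0_normE_ub (x - y) g) (Ae _ _ Ax Ay)).
  by rewrite distrC.
have l0 : l \in c0_pred.
  apply/c0_predP => e e0; have e20 : 0 < e / 2 by rewrite divr_gt0.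
  have [A FA Ae] := Fnear _ e20.
  have [x Ax] := @filter_ex _ F FF _ FA.
  apply: sub_finite_set (@c0_vanishing x _ e20) => g /= eg.
  have := lP _ _ FA Ae _ Ax g.
  have := lerB_dist (l g) (x g); rewrite distrC => h1 h2.
  have := le_trans h1 h2.
  by rewrite lerBlDl => /(lt_le_trans eg); rewrite {1}[e]splitr ltrD2r.
apply/cvg_ex; exists (C0 l0); apply/cvgrPdist_le => e e0.
have [A FA Ae] := Fnear _ e0.
apply: (@filterS _ F FF A _ _ FA) => x Ax; apply: c0_norm_le (ltW e0) _ => g.
by rewrite -normrN opprB; exact: lP Ax g.
Qed.

HB.instance Definition _ := Uniform_isComplete.Build c0 c0_complete.

End c0_space.

Section bodies.
Context {R : realType} {V : normedModType R}.
Implicit Types (B : set V) (N : V -> R).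

Definition body B : Prop :=
  [/\ closed B, convex_set B & B° !=set0].

Definition centrally_symmetric B : Prop :=
  exists c : V, [set x - c | x in B] = [set - (x - c) | x in B].

Definition equivalent_norm N : Prop :=
  [/\ forall x, N x = 0 -> x = 0,
      forall x y, N (x + y) <= N x + N y,
      forall (a : R) x, N (a *: x) = `|a| * N x &
      exists m M : R, [/\ 0 < m, 0 < M &
        forall x, m * `|x| <= N x /\ N x <= M * `|x|]].

(* [differentiable] is Frechet differentiability with a continuous linear
   differential. A bounded centrally symmetric set has a unique center, so [c]
   is the center of [B] and [N] is the gauge of [B - c]. *)
Definition frechet_smooth B : Prop :=
  exists c N, [/\ equivalent_norm N,
    B = [set c + y | y in [set y | N y <= 1]] &
    forall x, x != 0 -> differentiable N x].

End bodies.

(* A family of sets is a set of sets, i.e. it is indexed without repetition. *)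
Section families.
Context {T : Type}.
Implicit Type F : set (set T).

Definition covering F : Prop :=
  (forall B, F B -> B !=set0) /\ \bigcup_(B in F) B = [set: T].

Definition star_finite F : Prop :=
  forall B, F B ->
    finite_set [set B' | [/\ F B', B' <> B & B `&` B' !=set0]].

End families.

(* Main.v *)
Require Import Defs.
From HB Require Import structures.
From mathcomp Require Import all_boot all_order all_algebra finmap.
From mathcomp Require Import all_classical all_reals all_analysis.
From mathcomp Require Import zify ring lra.

(** A rounded box is the set of points at Euclidean distance at most [h] from a
    box [prod_i [c i - w i, c i + w i]] whose half-widths are bounded and
    bounded away from 0. Near a nonzero point its gauge depends on finitely
    many coordinates only, because an element of [c_0] reaches a given positive
    height on finitely many coordinates, and the squared excess over a threshold
    is continuously differentiable; hence the gauge is a Frechet smooth norm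
    ([gauge_differentiable], [rounded_box_frechet_smooth]).

    The covering consists of blocks, which are rounded boxes attached to a
    finite set [F] of coordinates, a mesh [h = 2^-k] and a centre in the lattice
    [(h Z)^F]: the half-width is [h] on [F] and 1 off [F]. A single block thus
    reaches across all coordinates off [F], so that it need not have a separate
    neighbour for each of them; and a point of it stays in it when coordinates
    off [F] are replaced by values in [[-1, 1]] ([block_flat]).

    Blocks over [F] are chosen by induction on [F]. Inside [R^F] the blocks over
    proper subsets of [F] already cover a closed set, and the blocks over [F]
    form a Whitney decomposition of the complement: [h] is comparable to the
    distance from the centre to the earlier blocks (or [h = 1] far away).

    - Every point is covered ([upto_cover]): with [F] the set of coordinates of
      size greater than 1, the restriction of [x] to [F] is in an earlier block
      or in a Whitney block over [F], and flatness puts back the coordinates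
      off [F]. The Whitney step needs the union of the blocks over subsets of
      [F] to be closed ([closed_upto]). It is: its complement consists of points
      with a coordinate [j] off [F] of size greater than 1, and blocks over [F]
      that come near such a point have mesh at least of the order of
      [|x j| - 1], so only finitely many do.
    - Blocks over distinct sets never meet ([block_meet]). Within [R^F] the earlier
      blocks contain every point with a coordinate of size at most 1, so the
      Whitney condition makes the coordinates in [F] of the centre at least
      [1 + 4 h]; hence on a block over [F] the coordinates in [F] are strictly
      larger than all others ([block_top]), which rules out incomparable sets.
      For comparable sets the Whitney condition itself separates the blocks.
    - A block over [F] meets finitely many blocks over the same [F]
      ([block_neighbour]), as in every Whitney decomposition of an open subset
      of a finite-dimensional space. *)

Set Implicit Arguments.
Unset Strict Implicit.
Unset Printing Implicit Defensive.

Import Order.TTheory GRing.Theory Num.Theory.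
Import numFieldNormedType.Exports.

Local Open Scope classical_set_scope.
Local Open Scope ring_scope.

(** * The squared excess over a threshold *)

Section scalar.
Variable R : realType.
Implicit Types a b t v w : R.

Definition pospart a : R := Num.max a 0.

Lemma pospart_ge0 a : 0 <= pospart a. Proof. by rewrite /pospart le_max lexx orbT. Qed.
Lemma pospart_ge a : a <= pospart a. Proof. by rewrite /pospart le_max lexx. Qed.
Lemma pospart_le0 a : a <= 0 -> pospart a = 0. Proof. by move=> ?; apply/max_idPr. Qed.
Lemma pospart_le a b : 0 <= b -> a <= b -> pospart a <= b.
Proof. by move=> b0 ab; rewrite /pospart ge_max ab. Qed.
Lemma pospartM t a : 0 <= t -> pospart (t * a) = t * pospart a.
Proof. by move=> t0; rewrite /pospart maxr_pMr// mulr0. Qed.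
Lemma pospart_mono a b : a <= b -> pospart a <= pospart b.
Proof. by move=> ab; apply: pospart_le (pospart_ge0 _) (le_trans ab (pospart_ge _)). Qed.

(** The squared positive part is differentiable with 2-Lipschitz derivative, so
    it lies below its second-order expansion at every point. *)
Lemma pospart_sqr_le a b : pospart (a + b) ^+ 2 <= pospart a ^+ 2 + 2 * pospart a * b + b ^+ 2.
Proof.
have -> : pospart a ^+ 2 + 2 * pospart a * b + b ^+ 2 = (pospart a + b) ^+ 2 by ring.
have [ab|ab] := leP (a + b) 0; first by rewrite (pospart_le0 ab) expr0n/= sqr_ge0.
rewrite /pospart (max_idPl (ltW ab)) ler_pXn2r ?nnegrE ?lerD2r ?pospart_ge//.
  exact: ltW.
by apply: le_trans (ltW ab) _; rewrite lerD2r pospart_ge.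
Qed.

(** Convexity of the perspective [(a, s) |-> pospart a ^+ 2 / s]; summed over
    the coordinates it gives the triangle inequality for the gauge. *)
Lemma pospart_sqr_add s t a b : 0 < s -> 0 < t ->
  pospart (a + b) ^+ 2 <= (s + t) * (pospart a ^+ 2 / s + pospart b ^+ 2 / t).
Proof.
move=> s0 t0.
have pab : pospart (a + b) <= pospart a + pospart b.
  by apply: pospart_le; rewrite ?addr_ge0 ?lerD ?pospart_ge0 ?pospart_ge.
apply: (@le_trans _ _ ((pospart a + pospart b) ^+ 2)).
  by rewrite ler_pXn2r ?nnegrE ?addr_ge0 ?pospart_ge0.
rewrite -subr_ge0.
have -> : (s + t) * (pospart a ^+ 2 / s + pospart b ^+ 2 / t) - (pospart a + pospart b) ^+ 2 =
    (t * pospart a - s * pospart b) ^+ 2 / (s * t).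
  by field; rewrite !gt_eqF.
by rewrite divr_ge0 ?sqr_ge0// mulr_ge0// ltW.
Qed.

(** [max (|v| - w) 0 ^+ 2] when [0 <= w]. Writing the absolute value as two
    one-sided terms makes the function continuously differentiable by inspection
    and keeps every estimate one-sided. *)
Definition excess2 w v : R := pospart (v - w) ^+ 2 + pospart (- v - w) ^+ 2.

Lemma excess2_ge0 w v : 0 <= excess2 w v.
Proof. by rewrite addr_ge0 ?sqr_ge0. Qed.

Lemma excess2_eq0 w v : `|v| <= w -> excess2 w v = 0.
Proof.
rewrite ler_norml => /andP[h1 h2].
by rewrite /excess2 !pospart_le0 ?expr0n ?addr0//= subr_le0// lerNl.
Qed.

Lemma excess2_le w v h : 0 <= h -> excess2 w v <= h ^+ 2 -> `|v| <= w + h.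
Proof.
move=> h0 e.
have e1 : pospart (v - w) ^+ 2 <= h ^+ 2 by apply: le_trans e; rewrite lerDl sqr_ge0.
have e2 : pospart (- v - w) ^+ 2 <= h ^+ 2 by apply: le_trans e; rewrite lerDr sqr_ge0.
rewrite ler_pXn2r ?nnegrE ?pospart_ge0// in e1.
rewrite ler_pXn2r ?nnegrE ?pospart_ge0// in e2.
have := le_trans (pospart_ge _) e1; have := le_trans (pospart_ge _) e2.
by rewrite ler_norml lerNl => h1 h2; apply/andP; split; lra.
Qed.

Lemma excess2Z a w v : excess2 (`|a| * w) (a * v) = a ^+ 2 * excess2 w v.
Proof.
rewrite /excess2; have [a0|a0] := leP 0 a.
  by rewrite ger0_norm// -mulrBr pospartM// -mulrN -mulrBr pospartM// mulrDr !exprMn.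
rewrite ltr0_norm//.
have na : 0 <= - a by lra.
have -> : a * v - - a * w = - a * (- v - w) by ring.
have -> : - (a * v) - - a * w = - a * (v - w) by ring.
by rewrite !pospartM//; ring.
Qed.

Lemma excess2_mono w w' v : w <= w' -> excess2 w' v <= excess2 w v.
Proof.
by move=> ww'; rewrite lerD// ler_pXn2r ?nnegrE ?pospart_ge0// pospart_mono// lerD2l lerN2.
Qed.

Lemma excess2_add s t w v v' : 0 < s -> 0 < t ->
  excess2 ((s + t) * w) (v + v') <=
  (s + t) * (excess2 (s * w) v / s + excess2 (t * w) v' / t).
Proof.
move=> s0 t0.
have := pospart_sqr_add (v - s * w) (v' - t * w) s0 t0.
have := pospart_sqr_add (- v - s * w) (- v' - t * w) s0 t0.
have -> : v - s * w + (v' - t * w) = v + v' - (s + t) * w by ring.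
have -> : - v - s * w + (- v' - t * w) = - (v + v') - (s + t) * w by ring.
rewrite /excess2 => h1 h2; apply: le_trans (lerD h2 h1) _.
by rewrite le_eqVlt; apply/orP; left; apply/eqP; ring.
Qed.

Lemma excess2_shift w v b y : excess2 (w + b) (v + y) <=
  excess2 w v + 2 * (pospart (v - w) - pospart (- v - w)) * y
  - 2 * (pospart (v - w) + pospart (- v - w)) * b + 2 * (y ^+ 2 + b ^+ 2).
Proof.
have := pospart_sqr_le (v - w) (y - b); have := pospart_sqr_le (- v - w) (- y - b).
have -> : v - w + (y - b) = v + y - (w + b) by ring.
have -> : - v - w + (- y - b) = - (v + y) - (w + b) by ring.
rewrite /excess2 => h1 h2; apply: le_trans (lerD h2 h1) _.
by rewrite le_eqVlt; apply/orP; left; apply/eqP; ring.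
Qed.

End scalar.

(** * A criterion for Frechet differentiability *)

Section differentiability.
Variables (R : realType) (V : normedModType R).

(** Midpoint convexity reflects the upper bound at [- y] into a lower bound at
    [y], so one-sided second-order control is enough for differentiability. *)
Lemma differentiable_of_quadratic_bound (N : V -> R) (L : {linear V -> R^o}) (x : V) (K C r : R) :
  0 < r -> (forall y, `|L y| <= K * `|y|) ->
  (forall y, 2 * N x <= N (x + y) + N (x - y)) ->
  (forall y, `|y| <= r -> N (x + y) <= N x + L y + C * `|y| ^+ 2) ->
  differentiable (N : V -> R^o) x.
Proof.
move=> r0 LK mid ub.
have Lc : continuous L.
  apply: bounded_linear_continuous; apply/linear_boundedP.
  near=> k => y; apply: le_trans (LK y) _.
  by rewrite ler_wpM2r//; near: k; exact: nbhs_pinfty_ge.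
have key : (N : V -> R^o) \o shift x = cst (N x : R^o) + L +o_ 0 id.
  apply/eqaddoP => e e0.
  have C0 : 0 < `|C| + 1 by rewrite ltr_wpDl.
  near=> y; have yr : `|y| <= Num.min r (e / (`|C| + 1)).
    near: y; apply/nbhs_ballP; exists (Num.min r (e / (`|C| + 1))) => /=.
      by rewrite lt_min r0 divr_gt0.
    by move=> z; rewrite -ball_normE/= sub0r normrN => /ltW.
  move: yr; rewrite le_min => /andP[yr yC].
  have h1 := ub y yr.
  have h2 := ub (- y); rewrite normrN linearN in h2.
  have h3 := mid y.
  rewrite -[leLHS]/(`|(N (y + x) - (N x + L y))%R|) addrC.
  rewrite [y + x]addrC; apply: (@le_trans _ _ (`|C| * `|y| ^+ 2)).
    have h4 : C * `|y| ^+ 2 <= `|C| * `|y| ^+ 2.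
      by rewrite ler_wpM2r ?sqr_ge0// ler_norm.
    have h5 := h2 yr.
    by rewrite ler_norml; apply/andP; split; lra.
  rewrite expr2 mulrA ler_wpM2r//.
  rewrite ler_pdivlMr// in yC; apply: le_trans yC.
  by rewrite mulrC ler_wpM2l// lerDl.
have dL := diff_unique Lc key.
by apply/diff_locallyP; rewrite dL.
Unshelve. all: by end_near. Qed.

End differentiability.

(** * The gauge of a rounded box *)

Section gauge.
Variables (R : realType) (T : choiceType) (w : T -> R) (m M h : R).
Hypotheses (m0 : 0 < m) (h0 : 0 < h) (mw : forall i, m <= w i) (wM : forall i, w i <= M).
Implicit Types (x y : c0 R T) (s t : R).

(** For [0 < t], [t] times the rounded box with half-widths [w] and radius [h]
    centred at 0. Bounding all finite partial sums avoids infinite sums and makes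
    convexity and closedness statements about finite sums. *)
Definition dilate t : set (c0 R T) :=
  [set x | forall A : {fset T}, \sum_(i <- A) excess2 (t * w i) (x i) <= (t * h) ^+ 2].

Definition gauge x : R := inf [set t | 0 < t /\ dilate t x].

Let w0 i : 0 < w i. Proof. exact: lt_le_trans (mw i). Qed.

Lemma dilateZ a t x : a != 0 -> dilate t x -> dilate (`|a| * t) (a *: x).
Proof.
move=> a0 tx A; rewrite -mulrA exprMn real_normK ?num_real//.
apply: le_trans (ler_wpM2l (sqr_ge0 a) (tx A)).
by rewrite mulr_sumr; apply: ler_sum => i _; rewrite -excess2Z mulrA.
Qed.

Lemma dilate_mono s t x : 0 <= s -> s <= t -> dilate s x -> dilate t x.
Proof.
move=> s0 st sx A; apply: (@le_trans _ _ ((s * h) ^+ 2)).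
  apply: le_trans (sx A); apply: ler_sum => i _; apply: excess2_mono.
  by rewrite ler_wpM2r// ltW.
by rewrite ler_pXn2r ?nnegrE ?mulr_ge0 ?ler_wpM2r ?(le_trans s0 st)// ltW.
Qed.

Lemma dilateD s t x y : 0 < s -> 0 < t -> dilate s x -> dilate t y -> dilate (s + t) (x + y).
Proof.
move=> s0 t0 sx ty A; pose S := \sum_(i <- A) excess2 (s * w i) (x i).
pose S' := \sum_(i <- A) excess2 (t * w i) (y i).
apply: (@le_trans _ _ ((s + t) * (S / s + S' / t))).
  rewrite /S /S' 2!mulr_suml -big_split/= mulr_sumr.
  by apply: ler_sum => i _; exact: excess2_add.
have -> : ((s + t) * h) ^+ 2 = (s + t) * ((s * h) ^+ 2 / s + (t * h) ^+ 2 / t).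
  by field; rewrite !gt_eqF.
apply: ler_wpM2l; first by rewrite addr_ge0// ltW.
by apply: lerD (ler_wpM2r _ (sx A)) (ler_wpM2r _ (ty A)); rewrite invr_ge0 ltW.
Qed.

Lemma dilate_coord t x i : 0 < t -> dilate t x -> `|x i| <= t * (w i + h).
Proof.
move=> t0 /(_ [fset i]%fset); rewrite big_seq_fset1 => /excess2_le.
by rewrite mulrDr; apply; rewrite mulr_ge0 ?ltW.
Qed.

Lemma box_dilate t x : (forall i, `|x i| <= t * w i) -> dilate t x.
Proof.
move=> xw A; rewrite big1 ?sqr_ge0// => i _; exact: excess2_eq0.
Qed.

Lemma norm_dilate t x : 0 <= t -> `|x| <= t * m -> dilate t x.
Proof.
move=> t0 xt; apply: box_dilate => i; apply: le_trans (c0_normE_ub x i) _.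
by apply: le_trans xt _; rewrite ler_wpM2l.
Qed.

(** Each partial sum is continuous in [t]; this is why the infimum that defines
    the gauge is attained. *)
Lemma dilate_lim t x : (forall e, 0 < e -> dilate (t + e) x) -> dilate t x.
Proof.
move=> tx A.
pose f s : R := (s * h) ^+ 2 - \sum_(i <- A) excess2 (s * w i) (x i).
have sqrc g : continuous (g : R -> R) -> continuous (fun s => g s ^+ 2).
  by move=> gc s; exact: (cvgM (gc s) (gc s)).
have mulc : continuous (fun s : R => s * h) by move=> s; apply: cvgMr_tmp.
have posc a b : continuous (fun s : R => pospart (a - s * b)).
  move=> s; apply: (@continuous_max R R (fun s => a - s * b) (cst 0)).
    by apply: cvgB; [exact: cvg_cst|apply: cvgMr_tmp].
  exact: cvg_cst.
have sumc : continuous (fun s : R => \sum_(i <- A) excess2 (s * w i) (x i) : R^o).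
  apply: continuous_big => [|i _ u]; first exact: add_continuous.
  exact: (cvgD (sqrc _ (posc (x i) (w i)) u) (sqrc _ (posc (- x i) (w i)) u)).
have fc : continuous (f : R -> R^o).
  by move=> s; exact: (cvgB (sqrc _ mulc s) (sumc s)).
rewrite -subr_ge0 -/(f t); rewrite leNgt; apply/negP => ft.
have /cvgrPdist_lt/(_ (- f t)) := fc t; rewrite oppr_gt0 => /(_ ft).
move=> /nbhs_ballP[d /= d0 dP].
have d2 : 0 < d / 2 by rewrite divr_gt0.
have := dP (t + d / 2); rewrite /ball/= opprD addrA subrr sub0r normrN gtr0_norm//.
have -> : d / 2 < d by lra.
move=> /(_ isT); have : 0 <= f (t + d / 2) by rewrite subr_ge0; exact: tx.
by move=> h1; rewrite distrC ltr_norml => /andP[_]; lra.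
Qed.

Let gset x := [set t | 0 < t /\ dilate t x].

Lemma gset_lb x : lbound (gset x) 0. Proof. by move=> t [/ltW]. Qed.

Lemma gset_nonempty x : gset x !=set0.
Proof.
exists ((`|x| + 1) / m); split; first by rewrite divr_gt0// ltr_wpDl.
by apply: norm_dilate; rewrite ?divr_ge0 ?addr_ge0 ?(ltW m0)// divfK ?gt_eqF// lerDl.
Qed.

Lemma gauge_ge0 x : 0 <= gauge x.
Proof. by apply: lb_le_inf; [exact: gset_nonempty|exact: gset_lb]. Qed.

Lemma gauge_le t x : 0 < t -> dilate t x -> gauge x <= t.
Proof. by move=> t0 tx; apply: ge_inf => //; exists 0; exact: gset_lb. Qed.

Lemma gauge_gt t x : gauge x < t -> dilate t x.
Proof.
move=> xt; have [s [s0 sx] st] := inf_lt (gset_nonempty x) xt.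
exact: dilate_mono (ltW s0) (ltW st) sx.
Qed.

Lemma dilate_gauge x : dilate (gauge x) x.
Proof. by apply: dilate_lim => e e0; apply: gauge_gt; rewrite ltrDl. Qed.

Lemma gauge_leP t x : 0 < t -> gauge x <= t <-> dilate t x.
Proof.
move=> t0; split=> [xt|]; last exact: gauge_le.
by apply: dilate_mono (gauge_ge0 x) xt (dilate_gauge x).
Qed.

Lemma gauge_upper x : gauge x <= m^-1 * `|x|.
Proof.
apply/ler_addgt0Pr => e e0; apply: gauge_le.
  by rewrite ltr_wpDl// mulr_ge0// invr_ge0 ltW.
apply: norm_dilate; first by rewrite addr_ge0 ?(ltW e0)// mulr_ge0// invr_ge0 ltW.
by rewrite mulrDl mulrAC mulVf ?gt_eqF// mul1r lerDl mulr_ge0// ltW.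
Qed.

Let Mh : 0 < `|M| + h. Proof. by rewrite ltr_wpDl. Qed.

Lemma gauge_lower x : (`|M| + h)^-1 * `|x| <= gauge x.
Proof.
apply/ler_addgt0Pr => e e0; rewrite ler_pdivrMl//; apply: c0_norm_le => [|i].
  by rewrite mulr_ge0 ?addr_ge0 ?gauge_ge0// ltW.
have t0 : 0 < gauge x + e by rewrite ltr_wpDl// gauge_ge0.
apply: le_trans (dilate_coord i t0 _) _; first by apply: gauge_gt; rewrite ltrDl.
by rewrite mulrC ler_wpM2r ?(ltW t0)// lerD2r (le_trans (wM i))// ler_norm.
Qed.

Lemma gaugeD x y : gauge (x + y) <= gauge x + gauge y.
Proof.
apply/ler_addgt0Pr => e e0; have e2 : 0 < e / 2 by rewrite divr_gt0.
have x0 : 0 < gauge x + e / 2 by rewrite ltr_wpDl// gauge_ge0.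
have y0 : 0 < gauge y + e / 2 by rewrite ltr_wpDl// gauge_ge0.
have -> : gauge x + gauge y + e = (gauge x + e / 2) + (gauge y + e / 2) by lra.
by apply: gauge_le; [exact: addr_gt0|apply: dilateD => //; apply: gauge_gt; rewrite ltrDl].
Qed.

Lemma gauge0 : gauge 0 = 0.
Proof.
by apply/eqP; rewrite eq_le gauge_ge0 andbT (le_trans (gauge_upper _))// normr0 mulr0.
Qed.

Lemma gaugeZ_le a x : gauge (a *: x) <= `|a| * gauge x.
Proof.
have [->|a0] := eqVneq a 0; first by rewrite scale0r gauge0 normr0 mul0r.
apply/ler_addgt0Pr => e e0; have a_gt0 : 0 < `|a| by rewrite normr_gt0.
have -> : `|a| * gauge x + e = `|a| * (gauge x + e / `|a|).
  by rewrite mulrDr mulrC mulrCA divff ?mulr1 ?gt_eqF.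
have e' : 0 < e / `|a| by rewrite divr_gt0.
apply: gauge_le; first by rewrite mulr_gt0// ltr_wpDl// gauge_ge0.
by apply: dilateZ => //; apply: gauge_gt; rewrite ltrDl.
Qed.

Lemma gaugeZ a x : gauge (a *: x) = `|a| * gauge x.
Proof.
apply/eqP; rewrite eq_le gaugeZ_le/=; have [->|a0] := eqVneq a 0.
  by rewrite normr0 mul0r gauge_ge0.
have := gaugeZ_le a^-1 (a *: x).
by rewrite scalerA mulVf// scale1r normrV ?unitfE// ler_pdivlMl ?normr_gt0.
Qed.

Lemma gauge_equivalent_norm : equivalent_norm gauge.
Proof.
split=> [x x0|||].
- apply/eqP; rewrite -normr_le0.
  by have := gauge_lower x; rewrite x0 ler_pdivrMl// mulr0.
- exact: gaugeD.
- exact: gaugeZ.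
exists (`|M| + h)^-1, m^-1; split; rewrite ?invr_gt0// => x.
by split; [exact: gauge_lower|exact: gauge_upper].
Qed.

End gauge.

(** * Differentiability of the gauge *)

Section coordinate_functional.
Variables (R : realType) (T : choiceType) (E : {fset T}) (a : T -> R).

Definition coordinate_functional (y : c0 R T) : R^o := \sum_(i <- E) a i * y i.

Fact coordinate_functional_linear : linear coordinate_functional.
Proof.
move=> b u v; rewrite /coordinate_functional scaler_sumr -big_split/=.
apply: eq_bigr => i _.
by rewrite [LHS](_ : _ = a i * (b * u i + v i))// mulrDr mulrCA.
Qed.

HB.instance Definition _ := GRing.isLinear.Build R (c0 R T) R^o _
  coordinate_functional coordinate_functional_linear.

Lemma coordinate_functional_bound y :
  `|coordinate_functional y| <= (\sum_(i <- E) `|a i|) * `|y|.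
Proof.
apply: le_trans (ler_norm_sum _ _ _) _; rewrite mulr_suml; apply: ler_sum => i _.
by rewrite normrM ler_wpM2l// c0_normE_ub.
Qed.

End coordinate_functional.

(** Reduces the bounds on all finite partial sums to the one over the set of
    active coordinates. *)
Lemma sum_fset_le_support (R : realType) (T : choiceType) (A E : {fset T}) (f : T -> R) :
  (forall i, 0 <= f i) -> (forall i, i \notin E -> f i = 0) ->
  \sum_(i <- A) f i <= \sum_(i <- E) f i.
Proof.
move=> f0 fE.
have -> : \sum_(i <- A) f i = \sum_(i <- A | i \in E) f i.
  by rewrite [RHS]big_mkcond; apply: eq_bigr => i _; case: ifPn => // /fE.
rewrite [leRHS](bigID (mem A))/= -[leLHS]big_filter -[X in _ <= X + _]big_filter.
rewrite (perm_big [seq i <- E | i \in A]); first by rewrite lerDl sumr_ge0.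
apply: uniq_perm; rewrite ?filter_uniq ?fset_uniq// => i.
by rewrite !mem_filter andbC.
Qed.

Section smoothness.
Variables (R : realType) (T : choiceType) (w : T -> R) (m M h : R).
Hypotheses (m0 : 0 < m) (h0 : 0 < h) (mw : forall i, m <= w i) (wM : forall i, w i <= M).

(** Let [t] be the gauge of [x]. For small [y] and [tau] the coordinates off the
    finite set [E] of those larger than [t * m / 2] contribute no excess to
    [x + y] at scale [t + tau]. On [E], expanding to second order shows that
    [x + y] belongs to the [t + tau] dilate as soon as [tau] is the solution of
    the linearised equation plus a multiple of [`|y| ^+ 2]. This solution is the
    differential: [D] is minus the derivative in [t] and [D * a i] the derivative
    in the [i]-th coordinate of [\sum excess2 (t * w i) (x i) - (t * h) ^+ 2]. *)
Lemma gauge_differentiable x : x != 0 -> differentiable (gauge w h : c0 R T -> R^o) x.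
Proof.
move=> x_neq0; set t := gauge w h x.
have t0 : 0 < t.
  apply: lt_le_trans (gauge_lower m0 h0 mw wM x).
  by rewrite mulr_gt0 ?normr_gt0// invr_gt0 ltr_wpDl.
have w0 i : 0 < w i by exact: lt_le_trans (mw i).
have tm0 : 0 < t * m / 2 by rewrite divr_gt0// mulr_gt0.
pose E : {fset T} := fset_set [set i | t * m / 2 < `|x i|].
have notE i : i \notin E -> `|x i| <= t * m / 2.
  rewrite in_fset_set; last exact: c0_vanishing.
  by move=> /negP; rewrite inE/= => /negP; rewrite -leNgt.
pose p i := pospart (x i - t * w i); pose n i := pospart (- x i - t * w i).
pose D := 2 * t * h ^+ 2 + \sum_(i <- E) 2 * (p i + n i) * w i.
have D0 : 0 < D.
  apply: ltr_wpDr; last by rewrite !mulr_gt0// exprn_gt0.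
  by apply: sumr_ge0 => i _; rewrite !mulr_ge0 ?addr_ge0 ?pospart_ge0// ltW.
pose a i := 2 * (p i - n i) / D.
(* The extra 1 absorbs the quadratic correction, since [Q / D * `|y| <= 1]. *)
pose K : R := (\sum_(i <- E) `|a i|) + 1.
have K0 : 0 < K by rewrite ltr_wpDl// sumr_ge0.
pose q : R := 2 * (1 + K ^+ 2 * M ^+ 2).
pose Q : R := \sum_(i <- E) q.
have q0 : 0 <= q by rewrite mulr_ge0// addr_ge0// mulr_ge0// sqr_ge0.
have C0 : 0 <= Q / D by rewrite divr_ge0 ?(ltW D0)// sumr_ge0.
have Km0 : 0 < 1 + K * m by rewrite addr_gt0// mulr_gt0.
(* The three bounds on [`|y|] ensure in turn that the correction is at most [`|y|],
   that [t + tau] stays positive, and that coordinates off [E] stay inactive. *)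
pose r := Num.min (Q / D + 1)^-1 (Num.min (t / 2 / K) (t * m / 2 / (1 + K * m))).
apply: (@differentiable_of_quadratic_bound _ _ _ (coordinate_functional E a) x
    (\sum_(i <- E) `|a i|) (Q / D) r).
- rewrite !lt_min invr_gt0 ltr_wpDl//= (divr_gt0 tm0 Km0) andbT.
  by rewrite divr_gt0// divr_gt0.
- exact: coordinate_functional_bound.
- move=> y; rewrite -[2]ger0_norm// -(gaugeZ m0 h0 mw).
  have -> : 2 *: x = (x + y) + (x - y) by rewrite addrACA subrr addr0 scaler_nat mulr2n.
  exact: (gaugeD m0 h0 mw).
move=> y; rewrite !le_min => /and3P[yC yK yKm].
rewrite -addrA; set tau := _ + _ * _.
have Cy : Q / D * `|y| <= 1.
  move: yC; rewrite -[X in _ <= X]mul1r ler_pdivlMr ?ltr_wpDl// mulrDr mulr1 mulrC.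
  by move=> /(le_trans _); apply; rewrite lerDl.
have tauK : `|tau| <= K * `|y|.
  apply: le_trans (ler_normD _ _) _; rewrite mulrDl mul1r lerD//.
    exact: coordinate_functional_bound.
  rewrite ger0_norm; last by rewrite mulr_ge0// sqr_ge0.
  rewrite expr2 mulrA.
  by rewrite -[leRHS]mul1r ler_wpM2r.
have taut : K * `|y| <= t / 2 by rewrite mulrC -ler_pdivlMr.
have tau1 : 0 < t + tau.
  by have := le_trans tauK taut; rewrite ler_norml => /andP[]; lra.
apply: gauge_le => // A.
apply: le_trans (@sum_fset_le_support _ _ A E _ _ _) _.
- by move=> i; exact: excess2_ge0.
- move=> i /notE xi; apply: excess2_eq0.
  apply: le_trans (ler_normD (x i) (y i)) _.
  apply: (@le_trans _ _ ((t + tau) * m)); last by rewrite ler_wpM2l// ltW.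
  have yi : `|y i| <= `|y| := c0_normE_ub y i.
  have : - (K * `|y|) <= tau by rewrite lerNl (le_trans _ tauK)// -normrN ler_norm.
  move=> /(ler_wpM2r (ltW m0)); rewrite mulNr.
  by move: yKm; rewrite ler_pdivlMr// => h1 h2; lra.
have term i : excess2 ((t + tau) * w i) ((x + y) i) <=
    excess2 (t * w i) (x i) + D * (a i * y i) - tau * (2 * (p i + n i) * w i)
    + q * `|y| ^+ 2.
  rewrite mulrDl; apply: le_trans (excess2_shift _ (x i) _ (y i)) _.
  rewrite -/(p i) -/(n i); apply: lerD.
    rewrite le_eqVlt; apply/orP; left; apply/eqP; rewrite /a.
    by field; rewrite gt_eqF.
  rewrite /q -[leRHS]mulrA ler_wpM2l// [leRHS]mulrDl mul1r lerD//.
    rewrite -[y i ^+ 2]real_normK ?num_real//.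
    by rewrite ler_pXn2r ?nnegrE// c0_normE_ub.
  have -> : K ^+ 2 * M ^+ 2 * `|y| ^+ 2 = (K * `|y| * M) ^+ 2 by ring.
  have M0 : 0 <= M := le_trans (ltW (w0 i)) (wM i).
  rewrite -[(tau * w i) ^+ 2]real_normK ?num_real// normrM (gtr0_norm (w0 i)).
  have yw : `|tau| * w i <= K * `|y| * M by exact: ler_pM (ltW (w0 i)) tauK (wM i).
  have tw : 0 <= `|tau| * w i by rewrite mulr_ge0// ltW.
  by rewrite ler_pXn2r// nnegrE// (le_trans tw).
apply: le_trans (ler_sum _ (fun i _ => term i)) _.
pose S := \sum_(i <- E) excess2 (t * w i) (x i).
have -> : \sum_(i <- E) (excess2 (t * w i) (x i) + D * (a i * y i)
      - tau * (2 * (p i + n i) * w i) + q * `|y| ^+ 2) =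
    S + D * coordinate_functional E a y
      - tau * (\sum_(i <- E) 2 * (p i + n i) * w i) + Q * `|y| ^+ 2.
  by rewrite /Q mulr_suml 2!mulr_sumr -sumrN -!big_split.
have St : S <= (t * h) ^+ 2 := dilate_gauge m0 h0 mw x E.
have -> : \sum_(i <- E) (2 * (p i + n i) * w i) = D - 2 * t * h ^+ 2.
  by rewrite /D [X in X - _]addrC addrK.
have Dtau : D * coordinate_functional E a y + Q * `|y| ^+ 2 = D * tau.
  by rewrite /tau; field; rewrite gt_eqF.
apply: (@le_trans _ _ ((t * h) ^+ 2 + 2 * tau * t * h ^+ 2)).
  have : tau * (D - 2 * t * h ^+ 2) = D * tau - 2 * tau * t * h ^+ 2 by ring.
  by lra.
rewrite -subr_ge0.
have -> : ((t + tau) * h) ^+ 2 - ((t * h) ^+ 2 + 2 * tau * t * h ^+ 2) = (tau * h) ^+ 2.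
  by ring.
exact: sqr_ge0.
Qed.

End smoothness.

(** * Rounded boxes are smooth bodies *)

Section norm_balls.
Variables (R : realType) (V : normedModType R) (B : set V).
Hypothesis B_smooth : frechet_smooth B.

Lemma frechet_smooth_bounded : bounded_set B.
Proof.
have [c [N [[_ _ _ [m [M [m0 _ mN]]]] -> _]]] := B_smooth.
rewrite /= /bounded_near; near=> K => _ [y /= Ny <-] /=.
apply: (@le_trans _ _ (`|c| + m^-1)); last by near: K; apply: nbhs_pinfty_ge; exact: num_real.
apply: le_trans (ler_normD _ _) _; rewrite lerD2l -[leRHS]mulr1 ler_pdivlMl//.
exact: le_trans (mN y).1 Ny.
Unshelve. all: by end_near. Qed.

Lemma frechet_smooth_symmetric : centrally_symmetric B.
Proof.
have [c [N [[_ _ NZ _] -> _]]] := B_smooth; exists c.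
have NN y : N (- y) = N y by rewrite -scaleN1r NZ normrN1 mul1r.
have Bsym y : N y <= 1 -> [set c + z | z in [set z | N z <= 1]] (c - y).
  by move=> Ny; exists (- y); rewrite //= NN.
have cK y : c + y - c = y by rewrite addrC addKr.
apply/seteqP; split=> _ [_ [y /= Ny <-] <-]; exists (c - y); rewrite ?cK ?opprK//; exact: Bsym.
Qed.

Lemma frechet_smooth_body : body B.
Proof.
have [c [N [[_ ND NZ [m [M [m0 M0 mN]]]] -> _]]] := B_smooth.
split.
- have -> : [set c + y | y in [set y | N y <= 1]] = [set z | N (z - c) <= 1].
    apply/seteqP; split=> [_ [y /= Ny <-]|z /= Nz]; first by rewrite (addrC c) addrK.
    by exists (z - c) => //; rewrite addrC subrK.
  rewrite -[X in closed X]setCK; apply: open_closedC; rewrite openE => z /=.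
  move=> /negP; rewrite -ltNge => Nz.
  apply/nbhs_ballP; exists ((N (z - c) - 1) / M) => /=.
    by rewrite divr_gt0// subr_gt0.
  move=> u; rewrite -ball_normE/= => zu; apply/negP; rewrite -ltNge.
  have -> : u - c = u - z + (z - c) by rewrite addrA subrK.
  have := ND (z - u) (u - c); rewrite addrA subrK => h1.
  rewrite ltr_pdivlMr// in zu.
  have h2 := (mN (z - u)).2.
  rewrite addrA subrK; rewrite mulrC in zu; lra.
- move=> _ _ l /set_mem[y /= Ny <-] /set_mem[z /= Nz <-]; apply/mem_set.
  exists (l%:num *: y + (1 - l%:num) *: z); last first.
    rewrite [RHS](_ : _ = l%:num *: (c + y) + (1 - l%:num) *: (c + z))//.
    by rewrite !scalerDr addrACA -scalerDl [l%:num + _]addrC subrK scale1r.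
  have l0 : 0 <= l%:num by [].
  have l1 : 0 <= 1 - l%:num by rewrite subr_ge0.
  rewrite /=; apply: le_trans (ND _ _) _; rewrite !NZ !ger0_norm//.
  by have := ler_wpM2l l0 Ny; have := ler_wpM2l l1 Nz; lra.
exists c; apply/nbhs_ballP; exists M^-1 => /=; first by rewrite invr_gt0.
move=> z; rewrite -ball_normE/= => cz; exists (z - c); last by rewrite addrC subrK.
apply: le_trans (mN _).2 _; rewrite distrC.
by rewrite -ler_pdivlMl// mulr1 ltW.
Qed.

End norm_balls.

Section rounded_box.
Variables (R : realType) (T : choiceType).
Implicit Types (w : T -> R) (h : R) (c x : c0 R T).

(** The closed Euclidean [h]-neighbourhood of the box of half-widths [w] centred
    at [c]. *)
Definition rounded_box w h c : set (c0 R T) :=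
  [set x | forall A : {fset T}, \sum_(i <- A) excess2 (w i) (x i - c i) <= h ^+ 2].

Lemma rounded_box_frechet_smooth w h c m M : 0 < m -> 0 < h ->
  (forall i, m <= w i) -> (forall i, w i <= M) -> frechet_smooth (rounded_box w h c).
Proof.
move=> m0 h0 mw wM; exists c, (gauge w h); split.
- exact: gauge_equivalent_norm m0 h0 mw wM.
- have dilate1 y : gauge w h y <= 1 <-> forall A : {fset T},
      \sum_(i <- A) excess2 (w i) (y i) <= h ^+ 2.
    have mul1 A : (\sum_(i <- A) excess2 (1 * w i) (y i) <= (1 * h) ^+ 2) =
        (\sum_(i <- A) excess2 (w i) (y i) <= h ^+ 2).
      by rewrite mul1r; congr (_ <= _); apply: eq_bigr => i _; rewrite mul1r.
    rewrite (gauge_leP m0 h0 mw)//.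
    by split=> hy A; [rewrite -mul1|rewrite mul1]; exact: hy.
  apply/seteqP; split=> [x xB|_ [y /= /dilate1 Ny <-] A].
    by exists (x - c); [apply/dilate1 => A; exact: xB|rewrite addrC subrK].
  apply: le_trans (Ny A); rewrite le_eqVlt; apply/orP; left; apply/eqP.
  by apply: eq_bigr => i _; congr excess2; rewrite [LHS](_ : _ = c i + y i - c i)// addrC addKr.
- by move=> x; exact: gauge_differentiable m0 h0 mw wM x.
Qed.

End rounded_box.

(** * Dyadic blocks *)

Section mesh.
Variable R : realType.

Definition mesh (k : nat) : R := 2^-1 ^+ k.

Lemma mesh_gt0 k : 0 < mesh k. Proof. by rewrite exprn_gt0// invr_gt0. Qed.

Lemma meshS k : mesh k = 2 * mesh k.+1.
Proof. by rewrite /mesh exprS mulrA divff ?mul1r// pnatr_eq0. Qed.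

Lemma mesh_anti k l : (k <= l)%N -> mesh l <= mesh k.
Proof.
elim: l => [|l IH]; first by rewrite leqn0 => /eqP->.
rewrite leq_eqVlt => /predU1P[->//|/IH]; apply: le_trans.
by rewrite (meshS l); have := mesh_gt0 l.+1; lra.
Qed.

Lemma mesh_le1 k : mesh k <= 1.
Proof. by have := mesh_anti (leq0n k); rewrite {2}/mesh expr0. Qed.

Lemma mesh_small e : 0 < e -> exists n, forall k, (n <= k)%N -> mesh k < e.
Proof.
move=> e0; exists (Num.bound e^-1) => k /upper_nthrootP.
rewrite /mesh exprVn -ltf_pV2 ?invrK// ?posrE ?invr_gt0// exprn_gt0//.
Qed.

End mesh.

Section cutoff.
Variables (R : realType) (T : choiceType).

Fact cutoff_subproof (F : {fset T}) (f : T -> R) :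
  (fun i => if i \in F then f i else 0) \in @c0_pred R T.
Proof.
apply/c0_predP => e e0; apply: (sub_finite_set _ (finite_fset F)) => i /=.
by case: ifP => //; rewrite normr0 ltNge ltW.
Qed.

Definition cutoff F f : c0 R T := C0 (cutoff_subproof F f).

Lemma cutoffE F f i : cutoff F f i = if i \in F then f i else 0.
Proof. by []. Qed.

Lemma c0_coord_le (x y : c0 R T) i : `|x i - y i| <= `|x - y|.
Proof. exact: (c0_normE_ub (x - y) i). Qed.

Lemma c0_dist_le (x y : c0 R T) e : 0 <= e ->
  (forall i, `|x i - y i| <= e) -> `|x - y| <= e.
Proof. by move=> e0 xy; apply: c0_norm_le e0 _ => i; exact: xy. Qed.

End cutoff.

Section blocks.
Variables (R : realType) (T : choiceType).
Implicit Types (F : {fset T}) (k : nat) (c x y : c0 R T).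

Definition half_width F k (i : T) : R := if i \in F then mesh R k else 1.

Definition block F k c : set (c0 R T) := rounded_box (half_width F k) (mesh R k) c.

Definition lattice F k : set (c0 R T) :=
  [set c | forall i, if i \in F then exists z : int, c i = z%:~R * mesh R k else c i = 0].

Lemma lattice_out F k c i : lattice F k c -> i \notin F -> c i = 0.
Proof. by move=> /(_ i); case: ifP. Qed.

Lemma block_frechet_smooth F k c : frechet_smooth (block F k c).
Proof.
apply: (@rounded_box_frechet_smooth _ _ _ _ _ (mesh R k) 1); rewrite ?mesh_gt0//.
  by move=> i; rewrite /half_width; case: ifP; rewrite ?mesh_le1.
by move=> i; rewrite /half_width; case: ifP; rewrite ?mesh_le1.
Qed.

Lemma block_coord F k c x i : block F k c x -> `|x i - c i| <= half_width F k i + mesh R k.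
Proof.
by move=> /(_ [fset i]%fset); rewrite big_seq_fset1; apply: excess2_le; exact/ltW/mesh_gt0.
Qed.

Lemma block_coord_in F k c x i : block F k c x -> i \in F -> `|x i - c i| <= 2 * mesh R k.
Proof. by move=> /(@block_coord _ _ _ _ i); rewrite /half_width => + iF; rewrite iF; lra. Qed.

Lemma block_coord_out F k c x i : lattice F k c -> block F k c x -> i \notin F ->
  `|x i| <= 1 + mesh R k.
Proof.
move=> cl /(@block_coord _ _ _ _ i) + iF.
by rewrite /half_width (negbTE iF) (lattice_out cl iF) subr0.
Qed.

Lemma box_block F k c x : lattice F k c ->
  (forall i, i \in F -> `|x i - c i| <= mesh R k) ->
  (forall i, i \notin F -> `|x i| <= 1) -> block F k c x.
Proof.
move=> cl xF xN A; rewrite big1 ?sqr_ge0// => i _; apply: excess2_eq0.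
rewrite /half_width; case: ifPn => iF; first exact: xF.
by rewrite (lattice_out cl iF) subr0; exact: xN.
Qed.

(** A coordinate off [F] that stays in [[-1, 1]] has no excess. *)
Lemma block_flat F k c x y : lattice F k c -> block F k c x ->
  (forall i, y i = x i \/ i \notin F /\ `|y i| <= 1) -> block F k c y.
Proof.
move=> cl xB yx A; apply: le_trans (xB A); apply: ler_sum => i _.
have [->//|[iF yi]] := yx i.
rewrite excess2_eq0 ?excess2_ge0// /half_width (negbTE iF).
by rewrite (lattice_out cl iF) subr0.
Qed.

Lemma closed_block F k c : closed (block F k c).
Proof. by have [] := frechet_smooth_body (block_frechet_smooth F k c). Qed.

Lemma lattice_approx F k x : exists2 c, lattice F k c &
  forall i, i \in F -> `|x i - c i| <= mesh R k.
Proof.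
have h0 := mesh_gt0 R k.
exists (cutoff F (fun i => (Num.floor (x i / mesh R k))%:~R * mesh R k)).
  by move=> i; rewrite cutoffE; case: (i \in F) => //; exists (Num.floor (x i / mesh R k)).
move=> i iF; rewrite cutoffE iF.
have /andP[] := floor_itv (x i / mesh R k).
rewrite intrD mulr1z ler_pdivlMr// ltr_pdivrMr// mulrDl mul1r => h1 h2.
by rewrite ger0_norm; lra.
Qed.

(** A lattice point of mesh at least [mesh n] and norm at most [M] is encoded by
    its integer coordinates, which lie between [- N] and [N]; shifting by [N]
    turns them into ordinals. *)
Lemma finite_lattice F n (M : R) : finite_set
  [set kc : nat * c0 R T | [/\ (kc.1 <= n)%N, lattice F kc.1 kc.2 & `|kc.2| <= M]].
Proof.
pose N := Num.bound (M / mesh R n).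
pose f (e : 'I_n.+1 * {ffun F -> 'I_(N + N).+1}) : nat * c0 R T :=
  (val e.1, cutoff F (fun i => if insub i is Some j
     then ((e.2 j)%:Z - N%:Z)%:~R * mesh R e.1 else 0)).
apply: (@sub_finite_set _ _ (f @` setT)); last exact/finite_image/finite_finset.
move=> [k c] /= [kn cl cM].
have h0 := mesh_gt0 R k; have hn0 := mesh_gt0 R n.
pose z i := Num.floor (c i / mesh R k).
have zE i : i \in F -> c i = (z i)%:~R * mesh R k.
  move=> iF; have := cl i; rewrite iF => -[u cu].
  by rewrite /z cu mulfK ?gt_eqF// intrKfloor.
have zN i : i \in F -> (`|z i| <= N%:Z)%R.
  move=> iF; rewrite -(ler_int R) intr_norm.
  have ci : `|c i| <= M by exact: le_trans (c0_normE_ub c i) cM.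
  have -> : (z i)%:~R = c i / mesh R k by rewrite (zE i iF) mulfK// gt_eqF.
  rewrite normrM normfV (gtr0_norm h0) ler_pdivrMr//.
  apply: le_trans ci _; have M0 : 0 <= M by exact: le_trans (normr_ge0 _) cM.
  apply: (@le_trans _ _ (N%:R * mesh R n)).
    by rewrite -ler_pdivrMr// ltW// archi_boundP// divr_ge0// ltW.
  by rewrite ler_wpM2l// mesh_anti.
exists (Ordinal (kn : (k < n.+1)%N), [ffun j => inord (absz (z (val j) + N%:Z))]) => //.
rewrite /f/=; congr pair; apply: val_inj; apply/funext => i /=.
have := cl i; case: ifP => // iF _.
rewrite insubT/= ffunE/= (zE i iF); congr (_%:~R * _).
have := zN i iF; rewrite ler_norml => /andP[z1 z2].
have zp : 0 <= z i + N%:Z by lia.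
by rewrite inordK; lia.
Qed.

End blocks.

(** * Selecting blocks by a Whitney condition *)

Section selection.
Variables (R : realType) (T : choiceType).
Implicit Types (F : {fset T}) (k n : nat) (c x y v : c0 R T) (K : set (c0 R T)).

(** [K] is meant to be the union of the earlier blocks. The constants leave room
    for rounding: a point at distance at least [5 h] from [K], with [h] the
    largest such mesh, is within [h] of a lattice point at distance at least
    [4 h] and less than [16 h] from [K]; and a block stays within [2 h] of its
    centre on [F]. The largest mesh is exempt from the upper bound. *)
Definition whitney K F k c : Prop :=
  [/\ lattice F k c,
      forall v, K v -> 4 * mesh R k <= `|c - v| &
      k = 0%N \/ exists2 v, K v & `|c - v| < 16 * mesh R k].

(** Stage [n] of the selection: the union of the selected blocks over the subsets
    of [F] with fewer than [n] elements. Recursion on the cardinality is a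
    structural form of the induction over proper subsets; [belowP] and [uptoP]
    are the interface used afterwards. *)
Fixpoint below_rank n F : set (c0 R T) :=
  if n is m.+1 then
    below_rank m F `|`
    [set x | exists F' k c, [/\ (F' `<=` F)%fset, #|` F'| = m,
      whitney (below_rank m F') F' k c & block F' k c x]]
  else set0.

Definition below F := below_rank #|` F| F.

Definition selected F k c : Prop := whitney (below F) F k c.

Definition upto F : set (c0 R T) :=
  [set x | exists F' k c, [/\ (F' `<=` F)%fset, selected F' k c & block F' k c x]].

Lemma below_rankP n F x : below_rank n F x <->
  exists F' k c, [/\ (F' `<=` F)%fset, (#|` F'| < n)%N, selected F' k c & block F' k c x].
Proof.
elim: n => [|n IH]; first by split=> // -[F' [k [c []]]].
split=> /= [[/IH[F' [k [c [FF ? ? ?]]]]|[F' [k [c [FF Fn ? ?]]]]]|].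
- by exists F', k, c; split=> //; exact: ltnW.
- by exists F', k, c; split; rewrite ?Fn//; rewrite /selected /below Fn.
move=> [F' [k [c [FF]]]]; rewrite ltnS leq_eqVlt => /predU1P[Fn sel xB|Fn sel xB].
  by right; exists F', k, c; split=> //; rewrite -Fn.
by left; apply/IH; exists F', k, c.
Qed.

Lemma belowP F x : below F x <->
  exists2 F', (F' `<` F)%fset & upto F' x.
Proof.
rewrite /below below_rankP; split=> [[F' [k [c [FF Fn sel xB]]]]|[F1 F1F [F' [k [c [FF sel xB]]]]]].
  exists F'; first by rewrite fproperEcard FF.
  by exists F', k, c; split.
have F'F := fsub_proper_trans FF F1F.
by exists F', k, c; split=> //; [exact: fproper_sub|exact: fproper_ltn_card].
Qed.

Lemma below_block F F' k c x : (F' `<` F)%fset -> selected F' k c -> block F' k c x ->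
  below F x.
Proof. by move=> FF sel xB; apply/belowP; exists F' => //; exists F', k, c. Qed.

Lemma uptoP F x : upto F x <->
  below F x \/ exists k c, selected F k c /\ block F k c x.
Proof.
split=> [[F' [k [c [/eqVfproper[->|FF] sel xB]]]]|].
- by right; exists k, c.
- by left; exact: below_block FF sel xB.
case=> [/belowP[F1 F1F [F' [k [c [FF sel xB]]]]]|[k [c [sel xB]]]].
  by exists F', k, c; split=> //; exact: fsubset_trans FF (fproper_sub F1F).
by exists F, k, c; split.
Qed.

Lemma upto_flat F x y : upto F x ->
  (forall i, y i = x i \/ i \notin F /\ `|y i| <= 1) -> upto F y.
Proof.
move=> [F' [k [c [FF sel xB]]]] yx; exists F', k, c; split=> //.
have [cl _ _] := sel; apply: (block_flat cl xB) => i.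
have [->|[iF yi]] := yx i; [by left|right; split=> //].
by apply: contra iF; exact: (fsubsetP FF).
Qed.

Lemma closed_below F : (forall F', (F' `<` F)%fset -> closed (upto F')) -> closed (below F).
Proof.
move=> cF.
have -> : below F = \bigcup_(F' in [set F' | (F' `<` F)%fset]) upto F'.
  by apply/seteqP; split=> [x /belowP[F' FF xF]|x [F' /= FF xF]];
    [exists F'|apply/belowP; exists F'].
apply: closed_bigcup => //.
apply: (sub_finite_set _ (finite_fset (fpowerset F))) => F' /= /fproper_sub.
by rewrite fpowersetE.
Qed.

(** Let [y] be the restriction of [x] to [F]. If [y] is in no earlier block, it
    has positive distance to their closed union, and rounding [y] in the coarsest
    mesh that fits this distance produces a selected block. *)
Lemma upto_full F x : closed (below F) -> (forall i, i \notin F -> `|x i| <= 1) -> upto F x.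
Proof.
move=> cF xN; pose y := cutoff F x.
have yx i : x i = y i \/ i \notin F /\ `|x i| <= 1.
  by rewrite cutoffE; case: ifPn => iF; [left|right; split=> //; exact: xN].
apply: (@upto_flat _ y) => //; apply/uptoP.
have [yF|yF] := pselect (below F y); [by left|right].
have [d d0 yd] : exists2 d, 0 < d & forall v, below F v -> d <= `|y - v|.
  have : open (~` below F) by exact: closed_openC.
  rewrite openE => /(_ y yF) /nbhs_ballP[d /= d0 dP]; exists d => // v vF.
  by rewrite leNgt; apply/negP => yv; apply: (dP v) => //; rewrite -ball_normE.
pose P k := `[< forall v, below F v -> 5 * mesh R k <= `|y - v| >].
have : exists k, P k.
  have [|k kP] := @mesh_small R (d / 5); first by rewrite divr_gt0.
  exists k; apply/asboolP => v /yd; apply: le_trans.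
  by have := kP k (leqnn k); rewrite ltr_pdivlMr// mulrC => /ltW.
move=> /ex_minnP[k /asboolP Pk kmin].
have [c cl cy] := lattice_approx F k y.
have h0 := mesh_gt0 R k.
have cdist : `|y - c| <= mesh R k.
  apply: c0_dist_le (ltW h0) _ => i; case: (boolP (i \in F)) => iF; first exact: cy.
  by rewrite (lattice_out cl iF) cutoffE (negbTE iF) subr0 normr0 ltW.
exists k, c; split; last first.
  by apply: box_block => // i iF; rewrite cutoffE (negbTE iF) normr0.
split=> //.
  move=> v /Pk yv.
  by have := ler_distD c y v; lra.
case: k => [|k] in Pk kmin cl cy h0 cdist *; [by left|right].
have : ~~ P k by apply/negP => /kmin; rewrite ltnn.
move=> /asboolPn; rewrite -existsNP => -[v]; rewrite not_implyE => -[vF /negP].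
rewrite -ltNge => yv; exists v => //.
have := ler_distD y c v; rewrite (distrC c y) (meshS R k) in yv *; lra.
Qed.

(** A point [x] outside has a coordinate [j] off [F] with [1 < `|x j|] by
    [upto_full]. A block over [F] bounds that coordinate by [1 + mesh R k], so
    blocks near [x] have their mesh bounded below and, being near [x], their
    centre bounded: there are finitely many, and each is closed. *)
Lemma closed_upto_step F : closed (below F) -> closed (upto F).
Proof.
move=> cF; rewrite -[upto F]setCK; apply: open_closedC; rewrite openE => x xF.
have [j jF xj] : exists2 j, j \notin F & 1 < `|x j|.
  apply: contrapT => nj; apply: xF; apply: upto_full => // i iF.
  by rewrite leNgt; apply/negP => xi; apply: nj; exists i.
pose e := (`|x j| - 1) / 2.
have e0 : 0 < e by rewrite divr_gt0// subr_gt0.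
have [n nP] := mesh_small e0.
pose S := [set kc : nat * c0 R T |
  [/\ (kc.1 <= n)%N, lattice F kc.1 kc.2 & `|kc.2| <= `|x| + e + 2]].
pose Z := below F `|` \bigcup_(kc in [set kc | S kc /\ selected F kc.1 kc.2])
  block F kc.1 kc.2.
have Zc : closed Z.
  apply: closedU => //; apply: closed_bigcup => [|kc _]; last exact: closed_block.
  by apply: (sub_finite_set _ (finite_lattice F n (`|x| + e + 2))) => kc [].
have Zx : ~ Z x.
  move=> [xb|[kc [_ sel] xB]]; apply: xF; apply/uptoP; first by left.
  by right; exists kc.1, kc.2.
have : open (~` Z) by exact: closed_openC.
rewrite openE => /(_ x Zx) /nbhs_ballP[d /= d0 dP].
apply/nbhs_ballP; exists (Num.min d e) => /=; first by rewrite lt_min d0.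
move=> y; rewrite -ball_normE/= lt_min => /andP[xyd xye] /uptoP yF.
apply: (dP y); first by rewrite -ball_normE.
case: yF => [yb|[k [c [sel yB]]]]; [by left|right].
exists (k, c) => //=; split=> //; have [cl _ _] := sel.
have xy i : `|x i - y i| <= e by exact: le_trans (c0_coord_le x y i) (ltW xye).
split=> //=.
  rewrite leqNgt; apply/negP => nk.
  have := block_coord_out cl yB jF; have := nP k (ltnW nk); have := xy j.
  have := lerB_dist (x j) (y j).
  have xjE : `|x j| = 1 + 2 * e by rewrite /e; lra.
  by rewrite xjE; lra.
apply: c0_norm_le => [|i]; first by rewrite !addr_ge0// ltW.
have [iF|iF] := boolP (i \in F); last first.
  by rewrite (lattice_out cl iF) normr0 !addr_ge0// ltW.
have := block_coord_in yB iF; have := xy i; have := mesh_le1 R k.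
have xi : `|x i| <= `|x| := c0_normE_ub x i.
have := ler_normD (x i) (c i - x i); rewrite addrC subrK.
have := ler_distD (y i) (x i) (c i); rewrite (distrC (c i) (x i)); lra.
Qed.

Lemma closed_upto F : closed (upto F).
Proof.
have [n] := ubnP #|` F|; elim: n => // n IH in F *; rewrite ltnS => Fn.
apply: closed_upto_step; apply: closed_below => F' FF; apply: IH.
exact: leq_trans (fproper_ltn_card FF) Fn.
Qed.

Lemma upto_cover F x : (forall i, i \notin F -> `|x i| <= 1) -> upto F x.
Proof. by apply: upto_full; apply: closed_below => F' _; exact: closed_upto. Qed.

Lemma dist_to_unit_ball (a : R) : exists2 b : R, `|b| <= 1 & `|a - b| <= pospart (`|a| - 1).
Proof.
have [a1|a1] := leP `|a| 1; first by exists a; rewrite ?subrr ?normr0 ?pospart_ge0.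
exists (Num.sg a); first by rewrite normr_sg lern1; case: (_ == _).
rewrite -{1}[a]mulr_sg_norm -{2}[Num.sg a]mulr1 -mulrBr normrM normr_sg.
have a0 : a != 0 by rewrite -normr_gt0 (lt_trans _ a1).
by rewrite a0 mul1r gtr0_norm ?subr_gt0// pospart_ge.
Qed.

(** Otherwise, moving the [i]-th coordinate of [c] to the nearest point of
    [[-1, 1]] displaces [c] by less than [4 h] and yields a point covered by
    blocks over subsets of [F `\ i], contrary to the Whitney condition. *)
Lemma selected_center F k c i : selected F k c -> i \in F -> 1 + 4 * mesh R k <= `|c i|.
Proof.
move=> [cl cb _] iF; rewrite leNgt; apply/negP => ci.
have [b b1 cb'] := dist_to_unit_ball (c i).
pose v := cutoff F (fun j => if j == i then b else c j).
have vb : below F v.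
  apply/belowP; exists (F `\ i)%fset; first exact: fproperD1.
  apply: upto_cover => j; rewrite !inE negb_and negbK => /orP[/eqP->|jF].
    by rewrite cutoffE iF eqxx.
  by rewrite cutoffE (negbTE jF) normr0.
have h0 := mesh_gt0 R k.
have := cb v vb; apply/negP; rewrite -ltNge.
apply: (@le_lt_trans _ _ (pospart (`|c i| - 1))).
  apply: c0_dist_le (pospart_ge0 _) _ => j; rewrite cutoffE.
  case: ifPn => jF; last by rewrite (lattice_out cl jF) subrr normr0 pospart_ge0.
  by case: eqVneq => [->//|_]; rewrite subrr normr0 pospart_ge0.
by rewrite /pospart gt_max; apply/andP; split; lra.
Qed.

(** Coordinates off [F] are at most [1 + h], while those in [F] are at least
    [1 + 4 h - 2 h]. *)
Lemma block_top F k c x i j : selected F k c -> block F k c x ->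
  i \in F -> j \notin F -> `|x j| < `|x i|.
Proof.
move=> sel xB iF jF; have [cl _ _] := sel; have h0 := mesh_gt0 R k.
have := selected_center sel iF; have := block_coord_in xB iF.
have := block_coord_out cl xB jF.
by have := lerB_dist (c i) (x i); rewrite distrC; lra.
Qed.

(** Restricting a common point to [F] keeps it in the block over [F'] and brings
    it within [2 h] of [c], where no earlier block reaches. *)
Lemma block_not_below F F' k k' c c' x : selected F k c -> selected F' k' c' ->
  block F k c x -> block F' k' c' x -> ~~ (F' `<` F)%fset.
Proof.
move=> sel sel' xB xB'; apply/negP => FF.
have [cl cb _] := sel; have h0 := mesh_gt0 R k.
pose y := cutoff F x.
have yB' : block F' k' c' y.
  have [cl' _ _] := sel'; apply: (block_flat cl' xB') => i; rewrite cutoffE.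
  case: ifPn => iF; [by left|right; rewrite normr0; split=> //].
  by apply: contra iF; exact: (fsubsetP (fproper_sub FF)).
have := cb y (below_block FF sel' yB'); apply/negP; rewrite -ltNge.
apply: (@le_lt_trans _ _ (2 * mesh R k)); last by lra.
apply: c0_dist_le => [|i]; first by rewrite mulr_ge0// ltW.
rewrite cutoffE; case: ifPn => iF; first by rewrite distrC; exact: block_coord_in.
by rewrite (lattice_out cl iF) subrr normr0 mulr_ge0// ltW.
Qed.

Lemma block_meet F F' k k' c c' x : selected F k c -> selected F' k' c' ->
  block F k c x -> block F' k' c' x -> F = F'.
Proof.
move=> sel sel' xB xB'.
have [FF|/fsubsetPn[i iF iF']] := boolP (F `<=` F')%fset.
  case: (eqVfproper FF) => // FF'.
  by have := block_not_below sel' sel xB' xB; rewrite FF'.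
have [FF|/fsubsetPn[j jF' jF]] := boolP (F' `<=` F)%fset.
  case: (eqVfproper FF) => // FF'.
  by have := block_not_below sel sel' xB xB'; rewrite FF'.
by have := lt_trans (block_top sel xB iF jF) (block_top sel' xB' jF' iF'); rewrite ltxx.
Qed.

(** A point of the earlier blocks within [16 h'] of [c'] is at distance at least
    [4 h] from [c], and the centres are within [2 h + 2 h'] of each other: hence
    [h <= 9 h'], which leaves a factor smaller than [2 ^ 5] between the meshes. *)
Lemma block_neighbour F k k' c c' x : selected F k c -> selected F k' c' ->
  block F k c x -> block F k' c' x -> (k' <= k + 4)%N /\ `|c'| <= `|c| + 4.
Proof.
move=> [cl cb _] [cl' _ cn'] xB xB'.
have h0 := mesh_gt0 R k; have h0' := mesh_gt0 R k'.
have cc : `|c - c'| <= 2 * mesh R k + 2 * mesh R k'.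
  apply: c0_dist_le => [|i]; first by lra.
  have [iF|iF] := boolP (i \in F).
    have := block_coord_in xB iF; have := block_coord_in xB' iF.
    by have := ler_distD (x i) (c i) (c' i); rewrite (distrC (c i) (x i)); lra.
  by rewrite (lattice_out cl iF) (lattice_out cl' iF) subrr normr0; lra.
split; last first.
  have := ler_normD c (c' - c); rewrite addrC subrK (distrC c' c).
  by have := mesh_le1 R k; have := mesh_le1 R k'; lra.
case: cn' => [->//|[v vb cv]].
have := cb v vb; have := ler_distD c' c v => h1 h2.
have hh : mesh R k <= 9 * mesh R k' by lra.
rewrite leqNgt; apply/negP => kk.
have := mesh_anti R kk; have := meshS R k; have := meshS R k.+1.
have := meshS R k.+2; have := meshS R k.+3.
by rewrite !addnS addn0 => e1 e2 e3 e4; have := meshS R k.+4; lra.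
Qed.

End selection.

(** * The covering *)

Section covering.
Variables (R : realType) (T : choiceType).

Definition blocks : set (set (c0 R T)) :=
  [set B | exists F k c, selected F k c /\ B = block F k c].

Lemma blocks_covering : covering blocks.
Proof.
split=> [_ [F [k [c [[cl _ _] ->]]]]|].
  exists c; have h0 := mesh_gt0 R k; apply: box_block => // i iF.
    by rewrite subrr normr0 ltW.
  by rewrite (lattice_out cl iF) normr0.
apply/seteqP; split=> // x _.
pose F : {fset T} := fset_set [set i | 1 < `|x i|].
have [i|F' [k [c [_ sel xB]]]] := @upto_cover R T F x.
  rewrite in_fset_set; last exact: c0_vanishing.
  by move=> /negP; rewrite inE/= => /negP; rewrite -leNgt.
by exists (block F' k c) => //; exists F', k, c.
Qed.

Lemma blocks_star_finite : star_finite blocks.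
Proof.
move=> _ [F [k [c [sel ->]]]].
pose S := [set kc : nat * c0 R T |
  [/\ (kc.1 <= k + 4)%N, lattice F kc.1 kc.2 & `|kc.2| <= `|c| + 4]].
apply: (@sub_finite_set _ _ ((fun kc => block F kc.1 kc.2) @` S)); last first.
  exact/finite_image/finite_lattice.
move=> _ [[F' [k' [c' [sel' ->]]]] _ [x [xB xB']]].
have FF := block_meet sel sel' xB xB'; rewrite -FF in sel' xB' *.
have [kk cc] := block_neighbour sel sel' xB xB'; have [cl' _ _] := sel'.
by exists (k', c').
Qed.

End covering.

Theorem theorem4p3 (R : realType) (G : Type) (infG : infinite_set [set: G]) :
  exists F : set (set (c0 R G)),
    [/\ covering F, star_finite F &
        forall B : set (c0 R G), F B ->
          [/\ body B, bounded_set B, centrally_symmetric B & frechet_smooth B]].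
Proof.
exists (@blocks R {classic G}); split.
- exact: (@blocks_covering R {classic G}).
- exact: (@blocks_star_finite R {classic G}).
move=> _ [F [k [c [_ ->]]]]; have smooth := block_frechet_smooth F k c.
split=> //; [exact: frechet_smooth_body|exact: frechet_smooth_bounded|].
exact: frechet_smooth_symmetric.
Qed.
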